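(* Let $B_{\frac{\pi}{6},2}(0)=\{\Delta\in T_E\operatorname{St}(n,p):\|\Delta\|_2<\tfrac{\pi}{6}\}$. For any $t\in[0,1]$ and any $\xi\in B_{\frac{\pi}{6},2}(0)$, the matrix $U=\operatorname{Exp}_E^{\mathrm{Canon}}(t\xi)\in\operatorname{St}(n,p)$ has a nonsingular upper $(p\times p)$ block $U_1$ whose polar factor $\tilde R\in O(p)$ in the polar decomposition $U_1=\tilde R\tilde H$ does not have the eigenvalue $-1$.
   Context: Let $p\le n$ be positive integers. $\operatorname{St}(n,p)=\{U\in\mathbb{R}^{n\times p}: U^TU=I_p\}$ is the Stiefel manifold and $E=\begin{bmatrix} I_p \\ 0 \end{bmatrix}\in\operatorname{St}(n,p)$. The tangent space $T_E\operatorname{St}(n,p)$ consists of all $\xi=\begin{bmatrix} A \\ B \end{bmatrix}$ with $A\in\mathbb{R}^{p\times p}$ skew-symmetric and $B\in\mathbb{R}^{(n-p)\times p}$. $\|\cdot\|_2$ is the spectral norm. $\operatorname{Exp}_E^{\mathrm{Canon}}$ is the Riemannian exponential map at $E$ under the canonical metric $g_c(\xi,\Delta)=\operatorname{tr}(\xi^T(I_n-\tfrac12UU^T)\Delta)$, given explicitly by $$\operatorname{Exp}_E^{\mathrm{Canon}}\left(\begin{bmatrix} A \\ B \end{bmatrix}\right)=\exp_m\left(\begin{bmatrix} A & -B^T \\ B & 0 \end{bmatrix}\right)E,$$ where $\exp_m$ is the matrix exponential. The polar decomposition of a nonsingular $U_1\in\mathbb{R}^{p\times p}$ is the unique factorization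 $U_1=\tilde R\tilde H$ with $\tilde R=U_1(U_1^TU_1)^{-1/2}\in O(p)$ orthogonal and $\tilde H=(U_1^TU_1)^{1/2}$ symmetric positive definite. *)

(* Defs.v *)
From HB Require Import structures.
From mathcomp Require Export all_boot all_order all_algebra.
From mathcomp Require Export all_classical all_reals all_analysis.
Set Implicit Arguments.
Unset Strict Implicit.
Unset Printing Implicit Defensive.
Import Order.TTheory GRing.Theory Num.Theory.
Export numFieldNormedType.Exports.

Local Open Scope classical_set_scope.
Local Open Scope ring_scope.

Definition norm2 (R : realType) (n : nat) (x : 'cV[R]_n) : R :=
  Num.sqrt (\sum_i x i 0 ^+ 2).

(* Spectral norm as the operator norm for Euclidean norms.  The set is bounded,
   and nonempty as soon as n > 0, so [sup] is the actual supremum. *)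
Definition spectral_norm (R : realType) (m n : nat) (M : 'M[R]_(m, n)) : R :=
  sup [set norm2 (M *m x) | x in [set x : 'cV[R]_n | norm2 x = 1]].

(* The series converges for every M, in the library's topology on matrices
   (that of entrywise convergence), so [limn] is its actual sum. *)
Definition expm (R : realType) (n : nat) (M : 'M[R]_n) : 'M[R]_n :=
  limn [series (k`!%:R^-1 : R) *: M ^+ k]_k.

Definition stiefel (R : realType) (n p : nat) : set 'M[R]_(n, p) :=
  [set U | U^T *m U = 1%:M].

(* From here on the ambient dimension is n = p + m, i.e. m = n - p >= 0. *)

Definition stiefel_E (R : realType) (p m : nat) : 'M[R]_(p + m, p) :=
  col_mx 1%:M 0.

Definition tangent_E (R : realType) (p m : nat) : set 'M[R]_(p + m, p) :=
  [set xi | (usubmx xi)^T = - usubmx xi].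

(* Closed form of the Riemannian exponential at E for the canonical metric
   tr (xi^T (I - U U^T / 2) Delta); it is meaningful for xi in [tangent_E]. *)
Definition Exp_E_canon (R : realType) (p m : nat) (xi : 'M[R]_(p + m, p)) :
    'M[R]_(p + m, p) :=
  let A := usubmx xi in
  let B := dsubmx xi in
  expm (block_mx A (- B^T) B 0) *m stiefel_E R p m.

Definition ball2_E (R : realType) (p m : nat) (r : R) : set 'M[R]_(p + m, p) :=
  [set Delta | tangent_E Delta /\ spectral_norm Delta < r].

Definition orthogonal_mx (R : realType) (p : nat) (Q : 'M[R]_p) : Prop :=
  Q^T *m Q = 1%:M.

Definition spd_mx (R : realType) (p : nat) (H : 'M[R]_p) : Prop :=
  H^T = H /\ forall x : 'cV[R]_p, x != 0 -> 0 < (x^T *m H *m x) 0 0.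

Definition polar_decomposition (R : realType) (p : nat) (M Q H : 'M[R]_p) :
    Prop :=
  [/\ M = Q *m H, orthogonal_mx Q & spd_mx H].

(* Main.v *)
(* Write [X] for the skew-symmetric block matrix whose exponential defines [U].
   Since the blocks of [xi] are bounded by [pi / 6], [X] is a contraction, so the
   alternating series [<x, exp X x> = sum_j (-1)^j |X^j x|^2 / (2j)!] is at least
   [|x|^2 / 2].  Hence [<v, U1 v> > 0] for [v != 0], and [U1] is nonsingular.  If
   [U1 = Q H] is a polar decomposition and [v Q = - v], i.e. [Q^T v^T = - v^T],
   then [<v, U1 v> = <Q^T v, H v> = - <v, H v> < 0], a contradiction.  The polar
   factor [H] exists because [1 - U1^T U1 = U2^T U2] is a strict contraction, so
   that [U1^T U1] has a square root. *)
From mathcomp Require Import ring lra zify.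
Require Import Defs.
Set Implicit Arguments.
Unset Strict Implicit.
Unset Printing Implicit Defensive.
Import Order.TTheory GRing.Theory Num.Theory.
Local Open Scope classical_set_scope.
Local Open Scope ring_scope.

(** * Euclidean inner product and operator bounds *)

Definition dot (R : realType) (n : nat) (x y : 'cV[R]_n) : R := (x^T *m y) 0 0.

Section Dot.
Context {R : realType}.
Implicit Types n : nat.

Lemma dotE n (x y : 'cV[R]_n) : dot x y = \sum_i x i 0 * y i 0.
Proof. by rewrite /dot mxE; apply: eq_bigr => i _; rewrite mxE. Qed.

Lemma dotC n (x y : 'cV[R]_n) : dot x y = dot y x.
Proof. by rewrite !dotE; apply: eq_bigr => i _; rewrite mulrC. Qed.

Lemma dotDr n (x y z : 'cV[R]_n) : dot x (y + z) = dot x y + dot x z.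
Proof. by rewrite /dot mulmxDr mxE. Qed.

Lemma dotZr n a (x y : 'cV[R]_n) : dot x (a *: y) = a * dot x y.
Proof. by rewrite /dot -scalemxAr mxE. Qed.

Lemma dotNr n (x y : 'cV[R]_n) : dot x (- y) = - dot x y.
Proof. by rewrite -scaleN1r dotZr mulN1r. Qed.

Lemma dotDl n (x y z : 'cV[R]_n) : dot (x + y) z = dot x z + dot y z.
Proof. by rewrite dotC dotDr !(dotC z). Qed.

Lemma dotZl n a (x y : 'cV[R]_n) : dot (a *: x) y = a * dot x y.
Proof. by rewrite dotC dotZr dotC. Qed.

Lemma dotNl n (x y : 'cV[R]_n) : dot (- x) y = - dot x y.
Proof. by rewrite dotC dotNr dotC. Qed.

Lemma dot0r n (x : 'cV[R]_n) : dot x 0 = 0.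
Proof. by rewrite /dot mulmx0 mxE. Qed.

Lemma dot0l n (x : 'cV[R]_n) : dot 0 x = 0.
Proof. by rewrite dotC dot0r. Qed.

Lemma dot_adj n k (M : 'M[R]_(n, k)) x y : dot x (M *m y) = dot (M^T *m x) y.
Proof. by rewrite /dot trmx_mul trmxK mulmxA. Qed.

Lemma dot_ge0 n (x : 'cV[R]_n) : 0 <= dot x x.
Proof. by rewrite dotE; apply: sumr_ge0 => i _; rewrite -expr2 sqr_ge0. Qed.

Lemma dot_gt0 n (x : 'cV[R]_n) : x != 0 -> 0 < dot x x.
Proof.
move=> x0; rewrite lt_neqAle dot_ge0 andbT eq_sym; apply: contra x0.
rewrite dotE psumr_eq0; last by move=> i _; rewrite -expr2 sqr_ge0.
move=> /allP h; apply/eqP/colP => i; rewrite mxE.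
by have := h i (mem_index_enum i); rewrite mulf_eq0 orbb => /eqP.
Qed.

Lemma coord_sqr_le_dot n (x : 'cV[R]_n) i : x i 0 ^+ 2 <= dot x x.
Proof.
rewrite dotE (bigD1 i)//= expr2 lerDl.
by apply: sumr_ge0 => j _; rewrite -expr2 sqr_ge0.
Qed.

Lemma dot_col_mx n k (x y : 'cV[R]_n) (z w : 'cV[R]_k) :
  dot (col_mx x z) (col_mx y w) = dot x y + dot z w.
Proof. by rewrite /dot tr_col_mx mul_row_col mxE. Qed.

Lemma norm2_sqr n (x : 'cV[R]_n) : norm2 x ^+ 2 = dot x x.
Proof.
rewrite /norm2 sqr_sqrtr; last by apply: sumr_ge0 => i _; exact: sqr_ge0.
by rewrite dotE; apply: eq_bigr => i _; rewrite expr2.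
Qed.

Lemma norm2_ge0 n (x : 'cV[R]_n) : 0 <= norm2 x.
Proof. exact: sqrtr_ge0. Qed.

(** The bound [|M x| <= c |x|] in squared form, which avoids suprema and square roots. *)
Definition op_le n k (c : R) (M : 'M[R]_(n, k)) : Prop :=
  forall x : 'cV[R]_k, dot (M *m x) (M *m x) <= c ^+ 2 * dot x x.

Lemma op_leW n k c d (M : 'M[R]_(n, k)) :
  0 <= c -> c <= d -> op_le c M -> op_le d M.
Proof.
move=> c0 cd Mc x; apply: le_trans (Mc x) _.
by rewrite ler_wpM2r ?dot_ge0// lerXn2r ?nnegrE// (le_trans c0).
Qed.

Lemma op_le0 n k c : op_le c (0 : 'M[R]_(n, k)).
Proof.
by move=> x; rewrite mul0mx dot0r mulr_ge0 ?sqr_ge0 ?dot_ge0.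
Qed.

Lemma op_leM n k l c d (M : 'M[R]_(n, k)) (N : 'M[R]_(k, l)) :
  op_le c M -> op_le d N -> op_le (c * d) (M *m N).
Proof.
move=> Mc Nd x; rewrite -mulmxA; apply: le_trans (Mc _) _.
by rewrite exprMn -[leRHS]mulrA ler_wpM2l ?sqr_ge0//; exact: Nd.
Qed.

Lemma op_leZ n k c a (M : 'M[R]_(n, k)) : op_le c M -> op_le (a * c) (a *: M).
Proof.
move=> Mc x; rewrite -scalemxAl dotZl dotZr mulrA -expr2 exprMn -[leRHS]mulrA.
by rewrite ler_wpM2l ?sqr_ge0//; exact: Mc.
Qed.

Lemma op_leD n k c d (M N : 'M[R]_(n, k)) : 0 < c -> 0 < d ->
  op_le c M -> op_le d N -> op_le (c + d) (M + N).
Proof.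
move=> c0 d0 Mc Nd x; have {}Mc := Mc x; have {}Nd := Nd x.
rewrite mulmxDl; set u := M *m x in Mc *; set v := N *m x in Nd *.
(* Young's inequality [2 <u, v> <= (d / c) |u|^2 + (c / d) |v|^2]. *)
have := dot_ge0 (d *: u - c *: v).
rewrite !(dotDl, dotDr, dotNl, dotNr, dotZl, dotZr) (dotC v u) => uv.
rewrite -(ler_pM2l (mulr_gt0 c0 d0)).
have h1 : d * (c + d) * dot u u <= d * (c + d) * (c ^+ 2 * dot x x).
  by rewrite ler_wpM2l// mulr_ge0 ?addr_ge0 ?ltW.
have h2 : c * (c + d) * dot v v <= c * (c + d) * (d ^+ 2 * dot x x).
  by rewrite ler_wpM2l// mulr_ge0 ?addr_ge0 ?ltW.
have -> : c * d * ((c + d) ^+ 2 * dot x x) =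
  d * (c + d) * (c ^+ 2 * dot x x) + c * (c + d) * (d ^+ 2 * dot x x) by ring.
(* The left sides of [h1] and [h2] add up to the left side of the goal plus exactly
   [|d u - c v|^2]. *)
apply: le_trans (lerD h1 h2); rewrite -subr_ge0; apply: le_trans uv _.
by rewrite le_eqVlt; apply/orP; left; apply/eqP; ring.
Qed.

Lemma op_le_expn n c (M : 'M[R]_n) k : op_le c M -> op_le (c ^+ k) (M ^+ k).
Proof.
move=> Mc; elim: k => [|k IH]; last by rewrite !exprS; apply: op_leM.
by move=> x; rewrite !expr0 expr1n mul1r mul1mx.
Qed.

(** With [y = M^T x], so that [<x, M y> = |y|^2], expanding [|c^2 x - M y|^2 >= 0] and using
    [|M y|^2 <= c^2 |y|^2] gives [c^2 |y|^2 <= c^4 |x|^2]. *)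
Lemma op_le_tr n k c (M : 'M[R]_(n, k)) : 0 < c -> op_le c M -> op_le c M^T.
Proof.
move=> c0 Mc x; set y := M^T *m x.
have e : dot x (M *m y) = dot y y by rewrite dot_adj.
have := dot_ge0 (c ^+ 2 *: x - M *m y).
rewrite !(dotDl, dotDr, dotNl, dotNr, dotZl, dotZr) (dotC (M *m y) x) e => h.
have {}Mc := Mc y.
rewrite -(ler_pM2l (exprn_gt0 2 c0)); lra.
Qed.

Lemma op_le_coord n k c (M : 'M[R]_(n, k)) i j : 0 <= c ->
  op_le c M -> `|M i j| <= c.
Proof.
move=> c0 Mc; rewrite -(ler_pXn2r (_ : 0 < 2)%N) ?nnegrE// real_normK ?num_real//.
have -> : M i j = (M *m (delta_mx j 0 : 'cV_k)) i 0 by rewrite -colE mxE.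
apply: le_trans (coord_sqr_le_dot _ _) _; apply: le_trans (Mc _) _.
rewrite -[leRHS]mulr1 ler_wpM2l ?sqr_ge0// dotE (bigD1 j)//= big1; last first.
  by move=> l lj; rewrite mxE (negbTE lj) mul0r.
by rewrite mxE !eqxx mul1r addr0.
Qed.

Lemma spectral_norm_op_le n k (M : 'M[R]_(n, k)) r :
  spectral_norm M <= r -> op_le r M.
Proof.
move=> Mr x; have [->|x0] := eqVneq x 0.
  by rewrite mulmx0 !dot0r mulr0.
have nx0 : 0 < norm2 x.
  rewrite lt_neqAle norm2_ge0 andbT eq_sym -sqrf_eq0 norm2_sqr.
  by rewrite gt_eqF ?dot_gt0.
pose y := (norm2 x)^-1 *: x.
have xy : x = norm2 x *: y by rewrite scalerA divff ?gt_eqF// scale1r.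
have y1 : norm2 y = 1.
  apply/eqP; rewrite -(@eqrXn2 _ 2) ?norm2_ge0// norm2_sqr dotZl dotZr -norm2_sqr.
  by apply/eqP; field; rewrite gt_eqF.
have My : norm2 (M *m y) <= r.
  apply: le_trans Mr; apply: ub_le_sup; last by exists y.
  (* The supremum dominates its elements only for a bounded set. Here the coordinates of a unit
     vector are at most 1 in absolute value, so row sums of [|M i j|] bound those of [M z]. *)
  exists (Num.sqrt (\sum_i (\sum_j `|M i j|) ^+ 2)) => _ [z /= z1 <-].
  rewrite /norm2 ler_wsqrtr// ler_sum// => i _; rewrite mxE.
  rewrite -[leLHS]real_normK ?num_real// lerXn2r ?nnegrE ?sumr_ge0//.
  apply: le_trans (ler_norm_sum _ _ _) _; apply: ler_sum => j _.
  rewrite normrM -[leRHS]mulr1 ler_wpM2l//.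
  rewrite -(ler_pXn2r (_ : 0 < 2)%N) ?nnegrE// real_normK ?num_real//.
  by apply: le_trans (coord_sqr_le_dot _ _) _; rewrite -norm2_sqr z1.
clearbody y; rewrite xy -scalemxAr !dotZl !dotZr -!norm2_sqr y1.
have : norm2 (M *m y) ^+ 2 <= r ^+ 2.
  by rewrite lerXn2r ?nnegrE ?norm2_ge0// (le_trans (norm2_ge0 _) My).
rewrite -(ler_pM2l (exprn_gt0 2 nx0)); lra.
Qed.

End Dot.

(** * Entrywise limits of matrices *)

Section MatrixLimits.
Context {R : realType} {T : Type} {F : set_system T} {FF : ProperFilter F}.

Lemma cvg_mxP n k (f : T -> 'M[R]_(n, k)) (L : 'M[R]_(n, k)) :
  f x @[x --> F] --> L <-> forall i j, f x i j @[x --> F] --> L i j.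
Proof.
split=> [fL i j|fL].
  apply: (cvg_comp _ (fun M : 'M[R]_(n, k) => M i j) fL).
  exact: coord_continuous.
(* A neighborhood of [L] contains a product of neighborhoods of its entries, and there are finitely
   many entries. *)
move=> A [P LP sPA]; suff : \forall x \near F, forall i j, P i j (f x i j).
  by rewrite nbhs_simpl /=; apply: filterS => x Px; apply: sPA.
apply: filter_forall => i; apply: filter_forall => j.
exact: fL (LP i j).
Qed.

Lemma cvg_mulmx n k l (f : T -> 'M[R]_(n, k)) (g : T -> 'M[R]_(k, l))
    (M : 'M[R]_(n, k)) (N : 'M[R]_(k, l)) :
  f x @[x --> F] --> M -> g x @[x --> F] --> N ->
  (f x *m g x) @[x --> F] --> M *m N.
Proof.
move=> /cvg_mxP fM /cvg_mxP gN; apply/cvg_mxP => i j.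
under eq_fun do rewrite mxE; rewrite mxE.
by apply: (cvg_big (@add_continuous R)) => h _; apply: cvgM.
Qed.

Lemma cvg_trmx n k (f : T -> 'M[R]_(n, k)) (M : 'M[R]_(n, k)) :
  f x @[x --> F] --> M -> (f x)^T @[x --> F] --> M^T.
Proof.
move=> /cvg_mxP fM; apply/cvg_mxP => i j.
by under eq_fun do rewrite mxE; rewrite mxE; exact: fM.
Qed.

Lemma cvg_dot n (f g : T -> 'cV[R]_n) (x y : 'cV[R]_n) :
  f t @[t --> F] --> x -> g t @[t --> F] --> y ->
  dot (f t) (g t) @[t --> F] --> dot x y.
Proof.
by move=> /cvg_trmx fx gy; have /cvg_mxP := cvg_mulmx fx gy; exact.
Qed.

Lemma op_le_lim n k c (f : T -> 'M[R]_(n, k)) (M : 'M[R]_(n, k)) :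
  f t @[t --> F] --> M -> (forall t, op_le c (f t)) -> op_le c M.
Proof.
move=> fM fc x; have fx : (f t *m x) @[t --> F] --> M *m x.
  by apply: cvg_mulmx => //; exact: cvg_cst.
apply: (cvgr_to_le (cvg_dot fx fx)).
by apply: nearW => t; exact: fc.
Qed.

End MatrixLimits.

Lemma mx_hausdorff (R : realType) n k : hausdorff_space 'M[R]_(n, k).
Proof. exact: norm_hausdorff. Qed.

(** * The matrix exponential series *)

(** An operator bound also bounds every entry, so each entry series converges absolutely by
    comparison. *)
Lemma is_cvg_series_op_le (R : realType) n k (u : nat -> 'M[R]_(n, k)) (v : R^nat) :
  (forall j, 0 <= v j) -> (forall j, op_le (v j) (u j)) ->
  cvgn (series v) -> cvgn (series u).
Proof.
move=> v0 uv cv; pose L := \matrix_(a, b) limn (series (fun j => u j a b)).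
suff : series u @ \oo --> L by exact: cvgP.
apply/cvg_mxP => a b; rewrite mxE.
have -> : (fun N => series u N a b) = series (fun j => u j a b).
  by apply/funext => N; rewrite /series/= summxE.
apply: (@normed_cvg R R^o); apply: (series_le_cvg _ v0 _ cv) => j /=.
  exact: normr_ge0.
exact: op_le_coord.
Qed.

Lemma cvg_expm (R : realType) n (M : 'M[R]_n) c : 0 <= c -> op_le c M ->
  [series (k`!%:R^-1 : R) *: M ^+ k]_k @ \oo --> expm M.
Proof.
move=> c0 Mc; apply: (is_cvg_series_op_le _ _ (is_cvg_series_exp_coeff c)) => k.
  by rewrite exp_coeff_ge0.
by rewrite /exp_coeff/= mulrC; apply: op_leZ; exact: op_le_expn.
Qed.

(** Summation along the antidiagonals [k = i + j], as in a Cauchy product. *)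
Lemma sum_triangle (V : nmodType) (f : nat -> nat -> V) N :
  \sum_(0 <= i < N) \sum_(0 <= j < N | (i + j < N)%N) f i j =
  \sum_(0 <= k < N) \sum_(0 <= i < k.+1) f i (k - i)%N.
Proof.
have -> : \sum_(0 <= k < N) \sum_(0 <= i < k.+1) f i (k - i)%N =
    \sum_(0 <= k < N) \sum_(0 <= i < N | (i <= k)%N) f i (k - i)%N.
  rewrite !big_nat; apply: eq_bigr => k /andP[_ kN].
  by rewrite (big_nat_widen _ _ N).
rewrite [RHS](exchange_big_dep_nat xpredT)//=.
rewrite !big_nat; apply: eq_bigr => i /andP[_ iN].
transitivity (\sum_(i <= k < N) f i (k - i)%N); last first.
  by rewrite (big_nat_widenl i 0).
have := big_addn 0 N i xpredT (fun k => f i (k - i)%N); rewrite add0n => ->.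
rewrite [RHS](big_nat_widen _ _ N) ?leq_subr//=.
by apply: eq_big => [j|j _]; rewrite ?addnK// ltn_subRL addnC.
Qed.

Lemma exp_coeffD (R : realType) (x y : R) k :
  \sum_(0 <= i < k.+1) (i`!%:R^-1 * x ^+ i) * ((k - i)`!%:R^-1 * y ^+ (k - i))
  = k`!%:R^-1 * (x + y) ^+ k.
Proof.
rewrite addrC exprDn big_mkord mulr_sumr; apply: eq_bigr => i _.
have ik : (i <= k)%N by rewrite -ltnS.
have fn0 j : j`!%:R != 0 :> R by rewrite pnatr_eq0 -lt0n fact_gt0.
rewrite -(bin_fact ik) !natrM mulrnAr -mulr_natr.
have : 'C(k, i)%:R != 0 :> R by rewrite pnatr_eq0 -lt0n bin_gt0.
move=> b0; field; rewrite b0 !fn0//.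
Qed.

(* The terms [X^(i+j)] with [i + j < N] of the product of the two partial sums
   cancel by the binomial theorem; those with [N <= i + j] are dominated by the
   same terms of the scalar product [exp c * exp c = exp (c + c)]. *)
Lemma expm_mulN (R : realType) n (X : 'M[R]_n) c : 0 <= c -> op_le c X ->
  expm (- X) *m expm X = 1%:M.
Proof.
move=> c0 Xc; have NXc : op_le c (- X).
  by move=> x; rewrite mulNmx dotNl dotNr opprK.
have S := cvg_mulmx (FF := eventually_filter) (cvg_expm c0 NXc) (cvg_expm c0 Xc).
apply: (cvg_unique (@mx_hausdorff _ _ _) S); apply/cvg_mxP => a b.
pose e (x : R) N := series (exp_coeff x) N.
pose u (x y : R) i j : R := (i`!%:R^-1 * x ^+ i) * (j`!%:R^-1 * y ^+ j).
have eE x y N : e x N * e y N = \sum_(0 <= i < N) \sum_(0 <= j < N) u x y i j.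
  rewrite /e /series/= mulr_suml; apply: eq_bigr => i _.
  by rewrite mulr_sumr; apply: eq_bigr => j _; rewrite /exp_coeff /u/=; ring.
have tri x y N :
    \sum_(0 <= i < N) \sum_(0 <= j < N | (i + j < N)%N) u x y i j = e (x + y) N.
  rewrite sum_triangle /e /series/=; apply: eq_bigr => k _.
  by rewrite exp_coeffD mulrC.
have split (V : nmodType) (w : nat -> nat -> V) N :
    \sum_(0 <= i < N) \sum_(0 <= j < N) w i j =
    \sum_(0 <= i < N) \sum_(0 <= j < N | (i + j < N)%N) w i j +
    \sum_(0 <= i < N) \sum_(0 <= j < N | ~~ (i + j < N)%N) w i j.
  rewrite -big_split/=; apply: eq_bigr => i _.
  exact: (bigID (fun j => i + j < N)%N).
(* The scalar terms with [N <= i + j]: their sum tends to [exp c * exp c - exp (c + c) = 0]. *)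
have cvgb : (e c N * e c N - e (c + c) N) @[N --> \oo] --> (0 : R).
  have <- : expR c * expR c - expR (c + c) = 0 by rewrite -expRD subrr.
  by apply: cvgB; [apply: cvgM|]; exact: is_cvg_series_exp_coeff.
apply/subr_cvg0/norm_cvg0P.
apply: (@squeeze_cvgr _ _ _ _ (cst 0)); [|exact: cvg_cst|exact: cvgb].
(* For [N = 0] the partial sums are empty and lack the term of index 0, which supplies the identity
   matrix. *)
exists 1%N => // N /= N0; rewrite normr_ge0/=.
have -> : ([series (k`!%:R^-1 : R) *: (- X) ^+ k]_k N *m
    [series (k`!%:R^-1 : R) *: X ^+ k]_k N) =
  \sum_(0 <= i < N) \sum_(0 <= j < N) u (-1) 1 i j *: X ^+ (i + j).
  rewrite /series/= mulmx_suml; apply: eq_bigr => i _.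
  rewrite mulmx_sumr; apply: eq_bigr => j _.
  rewrite -scalemxAl -scalemxAr scalerA exprD -mulmxE /u expr1n mulr1.
  rewrite -[- X]scaleN1r.
  have -> : (-1 *: X) ^+ i = (-1) ^+ i *: X ^+ i.
    elim: i => [|i IH]; first by rewrite !expr0 scale1r.
    by rewrite !exprS IH -!mulmxE -scalemxAl -scalemxAr scalerA.
  by rewrite -scalemxAl scalerA mulrAC.
rewrite eE !split tri addrAC subrr add0r.
(* The antidiagonal [k] contributes [(-1 + 1)^k / k!] times [X^k], so only [k = 0] survives. *)
have -> : \sum_(0 <= i < N) \sum_(0 <= j < N | (i + j < N)%N)
    u (-1) 1 i j *: X ^+ (i + j) = 1%:M.
  rewrite (sum_triangle (fun i j => u (-1) 1 i j *: X ^+ (i + j))).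
  rewrite -(prednK N0) big_nat_recl// [X in _ + X]big1_seq ?addr0; last first.
    move=> k _.
    transitivity (\sum_(0 <= i < k.+2) u (-1) 1 i (k.+1 - i)%N *: X ^+ k.+1).
      by apply: eq_big_nat => i /andP[_ ik]; rewrite subnKC.
    by rewrite -scaler_suml exp_coeffD addNr expr0n mulr0 scale0r.
  by rewrite big_nat1 /u subnn addn0 !expr0 fact0 invr1 !mulr1 scale1r.
rewrite mxE addrAC subrr add0r summxE.
apply: le_trans (ler_norm_sum _ _ _) _; apply: ler_sum => i _.
rewrite summxE; apply: le_trans (ler_norm_sum _ _ _) _; apply: ler_sum => j _.
rewrite mxE /u expr1n mulr1 !normrM normrX normrN1 expr1n mulr1 !normfV !normr_nat.
have : `|(X ^+ (i + j)) a b| <= c ^+ (i + j).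
  by rewrite op_le_coord ?exprn_ge0//; exact: op_le_expn.
by move=> h; rewrite [leRHS]mulrACA -exprD ler_wpM2l.
Qed.

(** * Exponentials of skew-symmetric matrices *)

Lemma dot_expr_skew (R : realType) n (X : 'M[R]_n) j (x y : 'cV[R]_n) :
  X^T = - X ->
  dot x (X ^+ j *m y) = (-1) ^+ j * dot (X ^+ j *m x) y.
Proof.
move=> skewX; elim: j x => [|j IH] x; first by rewrite !expr0 mul1r !mul1mx.
rewrite [in LHS]exprS -mulmxE -mulmxA dot_adj skewX mulNmx dotNl IH.
by rewrite [X ^+ j.+1]exprSr -mulmxE -mulmxA exprS mulN1r mulNr.
Qed.

Lemma dot_skew0 (R : realType) n (X : 'M[R]_n) (x : 'cV[R]_n) :
  X^T = - X -> dot x (X *m x) = 0.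
Proof.
move=> /(dot_expr_skew 1 x x); rewrite !expr1 mulN1r (dotC (X *m x) x); lra.
Qed.

(** The terms [a j] at least halve at each step, so the pairs [a 0 - a 1], [a 2 - a 3], ... are
    nonnegative and the first is at least [|x|^2 / 2]. *)
Lemma dot_expm_skew_ge (R : realType) n (X : 'M[R]_n) (x : 'cV[R]_n) :
  X^T = - X -> op_le 1 X -> dot x x / 2 <= dot x (expm X *m x).
Proof.
move=> skewX X1; pose u k := k`!%:R^-1 * dot x (X ^+ k *m x).
pose a j := (j.*2)`!%:R^-1 * dot (X ^+ j *m x) (X ^+ j *m x).
have ueven j : u j.*2 = (-1) ^+ j * a j.
  by rewrite /u /a -addnn exprD -mulmxE -mulmxA (dot_expr_skew _ _ _ skewX) mulrCA.
(* Up to sign, [<x, X^(2j+1) x>] is [<X^j x, X (X^j x)>], which vanishes by skew-symmetry. *)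
have uodd j : u j.*2.+1 = 0.
  rewrite /u -addnn -addnS exprD exprSr -!mulmxE -!mulmxA.
  rewrite (dot_expr_skew _ _ _ skewX).
  rewrite mulmxA mulmxE -exprSr exprS -mulmxE -mulmxA.
  by rewrite (dot_skew0 _ skewX) !mulr0.
have a0 j : 0 <= a j by rewrite mulr_ge0 ?invr_ge0 ?dot_ge0.
(* [X] is a contraction and [(2j+2)! >= 2 (2j)!]. *)
have aS j : a j.+1 <= a j / 2.
  rewrite /a exprS -mulmxE -mulmxA doubleS.
  have := X1 (X ^+ j *m x); rewrite expr1n mul1r => h.
  apply: le_trans (ler_wpM2l _ h) _; first by rewrite invr_ge0.
  rewrite mulrAC ler_wpM2r ?dot_ge0// -invfM.
  rewrite lef_pV2 ?posrE ?mulr_gt0 ?ltr0n ?fact_gt0//.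
  rewrite -natrM ler_nat !factS; nia.
(* Terms are grouped by four, the odd ones being zero. *)
have step N : series u (N.+1 * 4)%N =
    series u (N * 4)%N + (a N.*2 - a N.*2.+1).
  rewrite mulSn addnC !addnS addn0.
  rewrite /series/= !big_nat_recr//=.
  have -> : (N * 4 = N.*2.*2)%N by lia.
  rewrite -doubleS !uodd !ueven exprS.
  have -> : (-1) ^+ N.*2 = 1 :> R by rewrite -signr_odd odd_double.
  ring.
have ge N : dot x x / 2 <= series u (N.+1 * 4)%N.
  elim: N => [|N IH]; rewrite step.
    rewrite mul0n /series/= big_geq// add0r.
    have a00 : a 0%N = dot x x by rewrite /a fact0 invr1 mul1r expr0 mul1mx.
    have := aS 0%N; rewrite double0 a00; lra.
  by have := aS N.+1.*2; have := a0 N.+1.*2; lra.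
have Sx : (series [sequence k`!%:R^-1 *: X ^+ k]_k N *m x) @[N --> \oo] -->
    expm X *m x.
  apply: cvg_mulmx; [exact: (cvg_expm ler01 X1)|exact: cvg_cst].
have cu : series u @ \oo --> dot x (expm X *m x).
  have -> : series u =
      (fun N => dot x (series [sequence k`!%:R^-1 *: X ^+ k]_k N *m x)).
    apply/funext => N; rewrite /series/= mulmx_suml /dot mulmx_sumr summxE.
    by apply: eq_bigr => k _; rewrite -scalemxAl -scalemxAr mxE.
  by apply: cvg_dot => //; exact: cvg_cst.
(* The bound is known only for partial sums of length [4 (N + 1)]; this subsequence has the same
   limit. *)
have cS : (N.+1 * 4)%N @[N --> \oo] --> \oo.
  have -> : (fun N => (N.+1 * 4)%N) = (fun N => (N * 4 + 4)%N).
    by apply/funext => N; rewrite mulSn addnC.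
  apply: (cvg_comp (fun N => (N * 4)%N) (fun N => (N + 4)%N)).
    exact: cvg_mulnr.
  exact: cvg_addnr.
apply: (cvgr_to_ge (cvg_comp _ _ cS cu)).
by apply: nearW => N; exact: ge.
Qed.

Lemma trmx_expr (R : realType) n (M : 'M[R]_n) k : (M ^+ k)^T = M^T ^+ k.
Proof.
elim: k => [|k IH]; first by rewrite !expr0 trmx1.
by rewrite exprS exprSr -!mulmxE trmx_mul IH.
Qed.

Lemma trmx_expm (R : realType) n (M : 'M[R]_n) c : 0 < c -> op_le c M ->
  (expm M)^T = expm M^T.
Proof.
move=> c0 Mc.
have h := cvg_trmx (FF := eventually_filter) (cvg_expm (ltW c0) Mc).
apply: (cvg_unique (@mx_hausdorff _ _ _) h).
have -> : (fun N => (series [sequence k`!%:R^-1 *: M ^+ k]_k N)^T) =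
    series [sequence k`!%:R^-1 *: M^T ^+ k]_k.
  apply/funext => N; rewrite /series/= raddf_sum; apply: eq_bigr => k _ /=.
  by rewrite linearZ/= trmx_expr.
exact: cvg_expm (ltW c0) (op_le_tr c0 Mc).
Qed.

(** [(exp X)^T = exp (X^T) = exp (- X)], which is a left inverse of [exp X]. *)
Lemma expm_skew_orthogonal (R : realType) n (X : 'M[R]_n) c : 0 < c ->
  op_le c X -> X^T = - X -> orthogonal_mx (expm X).
Proof.
move=> c0 Xc skewX.
by rewrite /orthogonal_mx (trmx_expm c0 Xc) skewX (expm_mulN (ltW c0) Xc).
Qed.

(** * Square roots and existence of the polar decomposition *)

Lemma unitmx_ker0 (R : realType) n (M : 'M[R]_n) :
  (forall x : 'cV_n, M *m x = 0 -> x = 0) -> M \in unitmx.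
Proof.
move=> M0; rewrite -unitmx_tr unitmxE unitfE; apply/det0P => -[v v0 vM].
case/eqP: v0; apply: trmx_inj; rewrite trmx0; apply: M0.
by rewrite -[M]trmxK -trmx_mul vM trmx0.
Qed.

Lemma spd_mxE (R : realType) n (H : 'M[R]_n) (x : 'cV[R]_n) :
  (x^T *m H *m x) 0 0 = dot x (H *m x).
Proof. by rewrite /dot mulmxA. Qed.

Lemma spd_mx_unit (R : realType) n (H : 'M[R]_n) : spd_mx H -> H \in unitmx.
Proof.
move=> [_ Hpos]; apply: unitmx_ker0 => x Hx; apply/eqP/negPn/negP => /Hpos.
by rewrite spd_mxE Hx dot0r ltxx.
Qed.

(* [1 - Y] is a square root of [1 - Z] iff [Y] is a fixed point of
   [Y |-> (Z + Y^2) / 2], which is an [r]-contraction of the ball of radius [r]. *)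
Lemma sqrt_sub_contraction (R : realType) n (Z : 'M[R]_n) r : 0 < r < 1 ->
  Z^T = Z -> op_le r Z -> exists2 H, spd_mx H & H *m H = 1%:M - Z.
Proof.
move=> /andP[r0 r1] symZ Zr.
pose Y k : 'M[R]_n := iter k (fun Y => 2^-1 *: (Z + Y *m Y)) 0.
have YS k : Y k.+1 = 2^-1 *: (Z + Y k *m Y k) by [].
have tE k : telescope Y k = Y k.+1 - Y k by [].
have Yr k : op_le r (Y k).
  elim: k => [|k IH]; first exact: op_le0.
  (* The ball is preserved because [(r + r^2) / 2 <= r] for [r < 1]. *)
  rewrite YS; apply: op_leW (op_leZ 2^-1 (op_leD r0 _ Zr (op_leM IH IH))).
  - by rewrite mulr_ge0 ?invr_ge0 ?addr_ge0 ?mulr_ge0 ?ltW.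
  - nra.
  - exact: mulr_gt0.
have Ysym k : (Y k)^T = Y k.
  elim: k => [|k IH]; first by rewrite trmx0.
  by rewrite YS linearZ/= linearD/= trmx_mul IH symZ.
have dY k : op_le (r ^+ k.+1) (telescope Y k).
  elim: k => [|k IH].
    rewrite tE YS mulmx0 addr0 subr0.
    apply: op_leW (op_leZ 2^-1 Zr); first by rewrite mulr_ge0 ?invr_ge0 ?ltW.
    by rewrite expr1; lra.
  (* A difference of squares split without commutativity; the factors [Y k.+1] and [Y k] are each
     bounded by [r], so the average gains one factor [r]. *)
  have -> : telescope Y k.+1 =
      2^-1 *: (Y k.+1 *m telescope Y k + telescope Y k *m Y k).
    rewrite tE [Y k.+2]YS {2}[Y k.+1]YS -scalerBr; congr (_ *: _).
    by rewrite tE mulmxBr mulmxBl addrA subrK opprD addrACA subrr add0r.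
  have rk : 0 < r * r ^+ k.+1 by rewrite mulr_gt0 ?exprn_gt0.
  have := op_leZ 2^-1 (op_leD rk _ (op_leM (Yr k.+1) IH) (op_leM IH (Yr k))).
  rewrite [r ^+ k.+1 * r]mulrC -exprS => /(_ (exprn_gt0 _ r0)).
  by have -> : 2^-1 * (r ^+ k.+2 + r ^+ k.+2) = r ^+ k.+2 by field.
have cY : cvgn Y.
  have -> : Y = series (telescope Y).
    by rewrite telescopeK; apply/funext => k /=; rewrite subr0.
  apply: (is_cvg_series_op_le _ dY); first by move=> k; rewrite exprn_ge0 ?ltW.
  have -> : (fun k => r ^+ k.+1) = geometric r r.
    by apply/funext => k; rewrite /geometric/= exprS.
  by apply: is_cvg_geometric_series; rewrite gtr0_norm.
pose L : 'M[R]_n := limn Y.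
have YL : Y k @[k --> \oo] --> L by [].
have Lr : op_le r L by exact: (op_le_lim YL Yr).
have Lsym : L^T = L.
  have h := cvg_trmx (FF := eventually_filter) YL.
  apply: (cvg_unique (@mx_hausdorff _ _ _) h).
  by have -> : (fun k => (Y k)^T) = Y by exact/funext.
have Leq : L = 2^-1 *: (Z + L *m L).
  have h : Y k.+1 @[k --> \oo] --> L by rewrite (cvg_shiftS Y).
  apply: (cvg_unique (@mx_hausdorff _ _ _) h).
  by apply: cvgZr; apply: cvgD; [exact: cvg_cst|exact: cvg_mulmx].
exists (1%:M - L).
  split=> [|x x0]; first by rewrite linearB/= trmx1 Lsym.
  rewrite spd_mxE mulmxBl mul1mx dotDr dotNr.
  have xx := dot_gt0 x0; have Lx := Lr x.
  (* Together with [|L x| <= r |x|] this yields [<x, L x> <= r |x|^2 < |x|^2]. *)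
  have := dot_ge0 (r *: x - L *m x).
  rewrite !(dotDl, dotDr, dotNl, dotNr, dotZl, dotZr) (dotC (L *m x) x) => h.
  have : r * dot x (L *m x) <= r * (r * dot x x) by lra.
  rewrite (ler_pM2l r0); nra.
have {Leq} : L + L = Z + L *m L.
  by rewrite {1 2}Leq -scalerDl (_ : 2^-1 + 2^-1 = 1 :> R) ?scale1r//; field.
move=> LL; rewrite mulmxBl mul1mx mulmxBr mulmx1 opprB.
have -> : Z = L + L - L *m L by rewrite LL addrK.
by rewrite opprB opprD -addrA; congr (_ + _); rewrite addrCA.
Qed.

(** Take [H] with [H^2 = 1 - (1 - M^T M) = M^T M] and [Q = M H^-1]; then
    [Q^T Q = H^-1 H^2 H^-1 = 1]. *)
Lemma polar_decomposition_exists (R : realType) n (M : 'M[R]_n) r : 0 < r < 1 ->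
  op_le r (1%:M - M^T *m M) -> exists Q H, polar_decomposition M Q H.
Proof.
move=> r01 Zr; have [|H Hspd HH] := sqrt_sub_contraction r01 _ Zr.
  by rewrite linearB/= trmx1 trmx_mul trmxK.
have uH := spd_mx_unit Hspd; exists (M *m invmx H), H; split=> //.
  by rewrite mulmxKV.
rewrite opprB addrC subrK in HH.
rewrite /orthogonal_mx trmx_mul trmx_inv Hspd.1 mulmxA -(mulmxA _ M^T M) -HH.
by rewrite mulmxA mulVmx// mul1mx mulmxV.
Qed.

(** * The block matrix of a tangent vector and the theorem *)

(** For [y = (u, w)], [|A u - B^T w|^2 + |B u|^2 <= 2 |A u|^2 + 2 |B^T w|^2 + |B u|^2], at most [2
    |xi u|^2 + 2 c^2 |w|^2 <= |u|^2 + |w|^2]. *)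
Lemma block_skew_contraction (R : realType) p m (xi : 'M[R]_(p + m, p)) c :
  0 < c -> c ^+ 2 <= 2^-1 -> op_le c xi ->
  op_le 1 (block_mx (usubmx xi) (- (dsubmx xi)^T) (dsubmx xi) 0).
Proof.
move=> c0 c2 xic y.
rewrite -[y]vsubmxK; set u := usubmx y; set w := dsubmx y.
set A := usubmx xi; set B := dsubmx xi.
have xiE v : dot (xi *m v) (xi *m v) =
    dot (A *m v) (A *m v) + dot (B *m v) (B *m v).
  by rewrite -[xi]vsubmxK mul_col_mx dot_col_mx.
have Bc : op_le c B.
  by move=> v; apply: le_trans (xic v); rewrite xiE lerDr dot_ge0.
have hu := xic u; have hw := op_le_tr c0 Bc w.
rewrite mul_block_col mul0mx addr0 !dot_col_mx expr1n mul1r.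
rewrite xiE in hu; rewrite mulNmx.
have := dot_ge0 (A *m u + B^T *m w).
rewrite !(dotDl, dotDr, dotNl, dotNr) (dotC (B^T *m w)) => h.
have := dot_ge0 (B *m u).
have uu := dot_ge0 u; have ww := dot_ge0 w.
have : c ^+ 2 * dot u u <= 2^-1 * dot u u by rewrite ler_wpM2r.
have : c ^+ 2 * dot w w <= 2^-1 * dot w w by rewrite ler_wpM2r.
lra.
Qed.

Theorem theorem3p16 (R : realType) (p m : nat) (hp : (0 < p)%N)
    (t : R) (ht : 0 <= t <= 1)
    (xi : 'M[R]_(p + m, p)) (hxi : ball2_E (pi / 6) xi) :
  let U := Exp_E_canon (t *: xi) in
  let U1 := usubmx U in
  [/\ stiefel U,
      U1 \in unitmx,
      exists Rt Ht : 'M[R]_p, polar_decomposition U1 Rt Ht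
    & forall Rt Ht : 'M[R]_p, polar_decomposition U1 Rt Ht ->
        ~~ eigenvalue Rt (-1)].
Proof.
move=> U U1; move: hxi ht => [skew_xi xi_lt] /andP[t0 t1].
(* From [pi < 4] follows [pi / 6 < 2 / 3], and [(2 / 3)^2 = 4 / 9] is below the [1 / 2] that makes
   [X] a contraction. *)
have txi : op_le (2 / 3) (t *: xi).
  have xi_le : op_le (2 / 3) xi.
    apply: spectral_norm_op_le; apply: le_trans (ltW xi_lt) _.
    by have := @pihalf_lt2 R; lra.
  by apply: op_leW (op_leZ t xi_le); nra.
pose X : 'M[R]_(p + m) := block_mx (usubmx (t *: xi))
  (- (dsubmx (t *: xi))^T) (dsubmx (t *: xi)) 0.
have X1 : op_le 1 X by apply: block_skew_contraction txi; lra.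
have skewX : X^T = - X.
  rewrite /X tr_block_mx opp_block_mx trmx0 oppr0 !linearN/= trmxK opprK.
  congr block_mx.
  have -> : usubmx (t *: xi) = t *: usubmx xi by rewrite linearZ.
  by rewrite [(_ *: _)^T]linearZ/= (skew_xi : (usubmx xi)^T = _) scalerN.
have UE : U = expm X *m stiefel_E R p m by [].
have stU : U^T *m U = 1%:M.
  have orthX := expm_skew_orthogonal ltr01 X1 skewX.
  rewrite UE trmx_mul mulmxA -[_ *m _ *m expm X]mulmxA orthX mulmx1.
  by rewrite /stiefel_E tr_col_mx mul_row_col trmx1 mulmx1 trmx0 mulmx0 addr0.
(* [<v, U1 v> = <E v, exp X (E v)>] and [|E v| = |v|]. *)
have U1ge v : dot v v / 2 <= dot v (U1 *m v).
  have := dot_expm_skew_ge (stiefel_E R p m *m v) skewX X1.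
  rewrite [expm X *m _]mulmxA -UE /stiefel_E mul_col_mx mul1mx mul0mx.
  rewrite -[U]vsubmxK mul_col_mx !dot_col_mx.
  by rewrite !dot0l !addr0.
split=> //.
- apply: unitmx_ker0 => x U1x; apply/eqP/negPn/negP => /dot_gt0 x0.
  by have := U1ge x; rewrite U1x dot0r; lra.
- pose U2 := dsubmx U.
  have UU v : dot v v = dot (U1 *m v) (U1 *m v) + dot (U2 *m v) (U2 *m v).
    rewrite -dot_col_mx -mul_col_mx vsubmxK dot_adj.
    by rewrite mulmxA stU mul1mx.
  (* [|U2 v|^2 = |v|^2 - |U1 v|^2 <= 3/4 |v|^2 <= (7/8)^2 |v|^2]. *)
  have U2r : op_le (7 / 8) U2.
    move=> v; have := UU v; have := U1ge v; have := dot_ge0 (U1 *m v - 2^-1 *: v).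
    rewrite !(dotDl, dotDr, dotNl, dotNr, dotZl, dotZr) (dotC (U1 *m v) v).
    by have := dot_ge0 v; lra.
  apply: (@polar_decomposition_exists _ _ _ (7 / 8 * (7 / 8))); first by lra.
  have <- : U2^T *m U2 = 1%:M - U1^T *m U1.
    have : (col_mx U1 U2)^T *m col_mx U1 U2 = 1%:M by rewrite vsubmxK.
    by rewrite tr_col_mx mul_row_col => <-; rewrite addrAC subrr add0r.
  by apply: op_leM => //; apply: op_le_tr => //; lra.
- move=> Q H [U1E _ [_ Hpos]]; apply/negP => /eigenvalueP[v vQ v0].
  have Qv : Q^T *m v^T = - v^T by rewrite -trmx_mul vQ scaleN1r linearN.
  have w0 : v^T != 0 by rewrite trmx_eq0.
  have := U1ge v^T; have := dot_gt0 w0; have := Hpos _ w0.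
  rewrite spd_mxE U1E -mulmxA (dot_adj Q) Qv dotNl; lra.
Qed.
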